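(* For every integer $d\ge 1$, as formal power series in $q$, $$\sum_{n=0}^\infty r_d(n)q^n=\prod_{n=1}^{\infty}\frac{F_d\left(q^{(n-1)(d+1)+1},\,q\right)}{1-q^n},$$ where $r_d(n)$ is the number of $d$-fold partition diamonds of $n$ and $F_d(q_0,w)\in\mathbb{Z}[q_0,w]$ is the recursively defined polynomial, both as defined in the context.
   Context: Let $d\ge 1$ be an integer. A $d$-fold partition diamond consists of non-negative integers $a_i$ ($i\ge 0$) and $b_{i,j}$ ($i\ge 1$, $1\le j\le d$), called its parts, only finitely many of which are nonzero, such that $a_{i-1}\ge b_{i,j}\ge a_i$ for all $i\ge1$ and $1\le j\le d$. It is a $d$-fold partition diamond of $n$ if the sum of all its parts is $n$, i.e. $\sum_{i\ge 0}a_i+\sum_{i\ge1}\sum_{j=1}^d b_{i,j}=n$. Let $r_d(n)$ be the number of $d$-fold partition diamonds of $n$. The polynomials $F_d(q_0,w)\in\mathbb{Z}[q_0,w]$ ($d\ge1$) are defined by $F_1(q_0,w)=1$ and, for $d\ge2$, $$F_d(q_0,w)=\frac{(1-q_0w^d)F_{d-1}(q_0,w)-w(1-q_0)F_{d-1}(q_0w,w)}{1-w}$$ (the numerator is divisible by $1-w$, so this is a polynomial). The expression $F_d(q^{(n-1)(d+1)+1},q)$ denotes the evaluation at $q_0=q^{(n-1)(d+1)+1}$, $w=q$. *)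

(* Defs.v *)
From HB Require Import structures.
From mathcomp Require Import all_boot all_order all_algebra finmap.
From mathcomp Require Import boolp classical_sets functions cardinality.

Set Implicit Arguments.
Unset Strict Implicit.
Unset Printing Implicit Defensive.

Import GRing.Theory.
Local Open Scope classical_set_scope.
Local Open Scope ring_scope.

(* Formal power series over R, as a commutative unit ring. A record rather
   than an alias of nat -> R, which carries the pointwise ring structure. *)
Record fps (R : Type) := FPS { fps_coef :> nat -> R }.

HB.instance Definition _ (R : Type) := gen_eqMixin (fps R).
HB.instance Definition _ (R : Type) := gen_choiceMixin (fps R).

Section FormalPowerSeries.
Variable R : comNzRingType.
Implicit Types f g h : fps R.

Lemma fpsP f g : (forall k, f k = g k) -> f = g.
Proof. by case: f g => [f] [g] /= /funext ->. Qed.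

Definition fps_zero : fps R := FPS (fun=> 0).
Definition fps_opp f : fps R := FPS (fun k => - f k).
Definition fps_add f g : fps R := FPS (fun k => f k + g k).
Definition fps_const (c : R) : fps R := FPS (fun k => if k == 0 then c else 0).
Definition fps_mul f g : fps R := FPS (fun k => \sum_(i < k.+1) f i * g (k - i)%N).

Fact fps_addA : associative fps_add.
Proof. by move=> f g h; apply: fpsP => k /=; rewrite addrA. Qed.
Fact fps_addC : commutative fps_add.
Proof. by move=> f g; apply: fpsP => k /=; rewrite addrC. Qed.
Fact fps_add0 : left_id fps_zero fps_add.
Proof. by move=> f; apply: fpsP => k /=; rewrite add0r. Qed.
Fact fps_addN : left_inverse fps_zero fps_opp fps_add.
Proof. by move=> f; apply: fpsP => k /=; rewrite addNr. Qed.

HB.instance Definition _ :=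
  GRing.isZmodule.Build (fps R) fps_addA fps_addC fps_add0 fps_addN.

Let trunc N f : {poly R} := \poly_(i < N) f i.

Let coef_trunc_mul N f g k :
  (k < N)%N -> (trunc N f * trunc N g)`_k = fps_mul f g k.
Proof.
move=> kN; rewrite coefM; apply: eq_bigr => i _.
have iN : (i < N)%N by apply: leq_ltn_trans kN; rewrite -ltnS.
by rewrite !coef_poly iN (leq_ltn_trans (leq_subr _ _) kN).
Qed.

Fact fps_mulC : commutative fps_mul.
Proof.
by move=> f g; apply: fpsP => k; rewrite -!(coef_trunc_mul _ _ (ltnSn k)) mulrC.
Qed.

Fact fps_mulA : associative fps_mul.
Proof.
move=> f g h; apply: fpsP => k.
transitivity (trunc k.+1 f * (trunc k.+1 g * trunc k.+1 h))`_k.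
  rewrite coefM; apply: eq_bigr => i _.
  rewrite coef_poly ltn_ord coef_trunc_mul //.
  by rewrite ltnS leq_subr.
rewrite mulrA coefM; apply: eq_bigr => i _.
by rewrite coef_poly ltnS leq_subr coef_trunc_mul.
Qed.

Fact fps_mul1 : left_id (fps_const 1) fps_mul.
Proof.
move=> f; apply: fpsP => k /=; rewrite big_ord_recl /= mul1r subn0.
by rewrite big1 ?addr0 // => i _; rewrite mul0r.
Qed.

Fact fps_mulDl : left_distributive fps_mul fps_add.
Proof.
move=> f g h; apply: fpsP => k /=; rewrite -big_split /=.
by apply: eq_bigr => i _; rewrite mulrDl.
Qed.

Fact fps_oner_neq0 : fps_const 1 != 0 :> fps R.
Proof.
by apply/eqP => /(congr1 (fun f : fps R => f 0%N)) /eqP; rewrite oner_eq0.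
Qed.

HB.instance Definition _ := GRing.Zmodule_isComNzRing.Build (fps R)
  fps_mulA fps_mulC fps_mul1 fps_mulDl fps_oner_neq0.

Definition fps_unit : pred (fps R) := [pred f | `[< exists g, g * f = 1 >]].
Definition fps_inv f : fps R := xget f [set g | g * f = 1].

Fact fps_mulV : {in fps_unit, left_inverse 1 fps_inv *%R}.
Proof. by move=> f /asboolP /xgetPex; apply. Qed.
Fact fps_unitP f g : g * f = 1 -> fps_unit f.
Proof. by move=> fg; apply/asboolP; exists g. Qed.
Fact fps_inv_out : {in [predC fps_unit], fps_inv =1 id}.
Proof.
move=> f; rewrite inE /= => /asboolP nf.
by apply: xgetPN => g gf; apply: nf; exists g.
Qed.

HB.instance Definition _ := GRing.ComNzRing_hasMulInverse.Build (fps R)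
  fps_mulV fps_unitP fps_inv_out.

(* The indeterminate q. *)
Definition fps_X : fps R := FPS (fun k => if k == 1 then 1 else 0).

(* Convergence in the q-adic topology: every coefficient is eventually equal
   to the corresponding coefficient of the limit. *)
Definition fps_cvg (u : nat -> fps R) f :=
  forall k, exists N, forall M, (N <= M)%N -> u M k = f k.

End FormalPowerSeries.

(* The infinite product of the u n for n >= 1 converges to f. *)
Definition fps_prod_cvg (R : comNzRingType) (u : nat -> fps R) (f : fps R) :=
  fps_cvg (fun N => \prod_(1 <= n < N.+1) u n) f.

(* Z[q0, w] is {poly {poly int}}, with q0 the inner and w the outer
   variable. *)
Definition q0 : {poly {poly int}} := 'X%:P.
Definition w : {poly {poly int}} := 'X.

Definition eval2 (A : comNzRingType) (P : {poly {poly int}}) (x y : A) : A :=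
  (map_poly (fun p : {poly int} => (map_poly intr p).[x]) P).[y].

(* The value at d = 0 is a dummy. The division is the Euclidean division of
   polynomials in w, which is exact here by F_recE and has no scaling factor
   as the leading coefficient -1 of 1 - w is a unit. *)
Fixpoint F (d : nat) : {poly {poly int}} :=
  match d with
  | 0 | 1 => 1
  | (d'.+1 as e).+1 =>
      ((1 - q0 * w ^+ d) * F e - w * (1 - q0) * eval2 (F e) (q0 * w) w)
        %/ (1 - w)
  end.

Lemma eval2_at1 (P : {poly {poly int}}) : (eval2 P (q0 * w) w).[1] = P.[1].
Proof.
rewrite /eval2 horner_poly (horner_coef P) horner_sum; apply: eq_bigr => i _.
rewrite hornerM hornerXn !expr1n !mulr1.
rewrite [X in X.[1]](@horner_coef_wide _ (size P`_i)) ?size_poly // horner_sum.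
rewrite -[RHS]coefK poly_def; apply: eq_bigr => j _.
rewrite coef_map /= hornerM exprMn hornerM /q0 -polyC_exp hornerC hornerXn.
rewrite expr1n mulr1 -mul_polyC horner_int -[in RHS](intz P`_i`_j).
by rewrite rmorph_int.
Qed.

Lemma F_recE d : (1 < d)%N ->
  F d * (1 - w) =
  (1 - q0 * w ^+ d) * F d.-1 - w * (1 - q0) * eval2 (F d.-1) (q0 * w) w.
Proof.
case: d => [|[|d]] // _; set G := RHS; have -> : F d.+2 = G %/ (1 - w) by [].
have : root G 1.
  rewrite /root /G hornerD hornerN !hornerM eval2_at1 !hornerD !hornerN hornerM.
  by rewrite horner_exp !hornerC !hornerX expr1n mulr1 mul1r subrr.
case/factor_theorem => g ->.
have -> : g * ('X - 1%:P) = - g * (1 - w) by rewrite mulNr -mulrN opprB.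
rewrite Pdiv.IdomainUnit.mulpK //.
by rewrite -opprB lead_coefN -[1]/(1%:P) lead_coefXsubC unitrN unitr1.
Qed.

(* A d-fold partition diamond is a pair (a, b) with a i standing for a_i and
   b (i, j) for b_{i+1,j+1}; only finitely many parts are nonzero. *)
Definition parts (d : nat) : choiceType :=
  ({fsfun nat -> nat with 0%N} * {fsfun nat * 'I_d -> nat with 0%N})%type.

Definition is_diamond d (D : parts d) : Prop :=
  forall (i : nat) (j : 'I_d),
    (D.2 (i, j) <= D.1 i)%N /\ (D.1 i.+1 <= D.2 (i, j))%N.

Definition diamond_sum d (D : parts d) : nat :=
  (\sum_(i <- finsupp D.1) D.1 i + \sum_(ij <- finsupp D.2) D.2 ij)%N.

Definition diamonds d n : set (parts d) :=
  [set D | is_diamond D /\ diamond_sum D = n].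

Arguments diamonds : clear implicits.

Lemma leq_sum_finsupp (K : choiceType) (f : {fsfun K -> nat with 0%N}) s :
  uniq s -> (\sum_(i <- s) f i <= \sum_(i <- finsupp f) f i)%N.
Proof.
move=> us; rewrite (bigID (fun i => i \in finsupp f)) /=.
rewrite [X in (_ + X)%N]big1 ?addn0; last by move=> i /fsfun_dflt.
rewrite -big_filter.
apply: (uniq_sub_le_big leqnn (fun x y => leq_addr y x)) => [||i].
- exact: filter_uniq.
- exact: fset_uniq.
- by rewrite mem_filter => /andP[].
Qed.

Lemma diamonds_bound d n (D : parts d) : (1 <= d)%N -> diamonds d n D ->
  [/\ forall i, (D.1 i <= n)%N, forall i j, (D.2 (i, j) <= n)%N &
      forall i, (n < i)%N -> D.1 i = 0%N /\ forall j, D.2 (i, j) = 0%N].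
Proof.
move=> d0 [Dd Dn].
have sumD s : uniq s -> (\sum_(i <- s) D.1 i <= n)%N.
  move=> us; rewrite -Dn; apply: leq_trans (leq_addr _ _).
  exact: leq_sum_finsupp.
have Dle i : (D.1 i <= n)%N.
  by have := sumD [:: i] isT; rewrite big_seq1.
have Dble i j : (D.2 (i, j) <= D.1 i)%N by case: (Dd i j).
have Dnincr i k : (i <= k)%N -> (D.1 k <= D.1 i)%N.
  elim: k => [|k IH]; first by rewrite leqn0 => /eqP ->.
  rewrite leq_eqVlt => /predU1P[-> //|/IH]; apply: leq_trans.
  by have [h1 h2] := Dd k (Ordinal d0); apply: leq_trans h2 h1.
have Da0 i : (n < i)%N -> D.1 i = 0%N.
  move=> ni; apply/eqP; rewrite -leqn0 leqNgt; apply/negP => Di.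
  have := sumD _ (iota_uniq 0 i); rewrite leqNgt => /negP; apply.
  apply: leq_trans ni _; rewrite -[X in (X <= _)%N](size_iota 0) -sum1_size.
  rewrite !big_seq; apply: leq_sum => k; rewrite mem_iota add0n => /andP[_ ki].
  by apply: leq_trans Di _; apply: Dnincr; apply: ltnW.
split=> // [i j|i ni]; first exact: leq_trans (Dble i j) (Dle i).
split=> [|j]; first exact: Da0.
by apply/eqP; rewrite -leqn0; have := Dble i j; rewrite (Da0 _ ni).
Qed.

Lemma diamonds_finite d n : (1 <= d)%N -> finite_set (diamonds d n).
Proof.
move=> d0.
pose f (D : parts d) : {ffun 'I_n.+1 -> 'I_n.+1} * {ffun 'I_n.+1 * 'I_d -> 'I_n.+1}
  := ([ffun i => inord (D.1 (val i))], [ffun ij => inord (D.2 (val ij.1, ij.2))]).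
have injf D D' : diamonds d n D -> diamonds d n D' -> f D = f D' -> D = D'.
  move=> /(diamonds_bound d0)[Ea Eb E0] /(diamonds_bound d0)[Ea' Eb' E0'].
  case=> /ffunP fa /ffunP fb; case: D D' Ea Eb E0 Ea' Eb' E0' fa fb.
  move=> a b [a' b'] /= Ea Eb E0 Ea' Eb' E0' fa fb; congr pair; apply/fsfunP.
    move=> i; have [ni|ni] := ltnP n i; first by case: (E0 i ni) (E0' i ni) => -> _ [-> _].
    move: (fa (Ordinal (ni : (i < n.+1)%N))); rewrite !ffunE /=.
    by move=> /(congr1 val); rewrite /= !inordK ?ltnS.
  move=> [i j]; have [ni|ni] := ltnP n i.
    by case: (E0 i ni) (E0' i ni) => _ -> [_ ->].
  move: (fb (Ordinal (ni : (i < n.+1)%N), j)); rewrite !ffunE /=.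
  by move=> /(congr1 val); rewrite /= !inordK ?ltnS.
pose g y : parts d := xget ([fsfun], [fsfun]) [set D | diamonds d n D /\ f D = y].
apply: (@sub_finite_set _ _ (range g)); last first.
  exact/finite_image/finite_finset.
move=> D DD; exists (f D) => //.
have /(@xgetPex _ ([fsfun], [fsfun]) _)[gD fgD] :
  exists D', [set D' | diamonds d n D' /\ f D' = f D] D' by exists D.
exact: injf.
Qed.

(* For d >= 1 the set is finite by diamonds_finite. *)
Definition r d n : nat := #|` fset_set (diamonds d n)|.

(* Main.v *)
Require Import Defs.
From HB Require Import structures.
From mathcomp Require Import all_boot all_order all_algebra finmap.
From mathcomp Require Import boolp classical_sets functions cardinality.
From mathcomp Require Import ring.
Import GRing.Theory.
Local Open Scope ring_scope.

(** A diamond is determined by the drops k_i = a_(i-1) - a_i >= 0 and the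
    excesses c_ij = b_ij - a_i, where 0 <= c_ij <= k_i. In these coordinates
    the rows are independent, and the sum of the parts is the total of
    k_i ((i-1)(d+1) + 1) + sum_j c_ij, because raising k_i by one raises a_0,
    ..., a_(i-1) and all middle parts between them. Hence the generating
    function is the product over i >= 1 of S_d(q^((i-1)(d+1)+1)), where
      S_d(x) = sum_k x^k (1 + q + ... + q^k)^d.

    Writing one factor 1 + ... + q^k as (1 - q^(k+1)) / (1 - q) gives
      (1 - q) S_(d+1)(x) = S_d(x) - q S_d(x q),
    which after clearing denominators is the recurrence of F, so that
      S_d(x) = F_d(x, q) / ((1 - x) (1 - x q) ... (1 - x q^d))
    (row_seriesP). For x = q^((i-1)(d+1)+1) the denominators of the successive
    rows run through 1 - q^n for all n >= 1, each once (prod_row_series).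

    To read off the coefficient of q^n it suffices to work with M > n rows and
    drops below M, modulo q^M. Then the product of the truncated S_d is a sum
    over a finite type of coordinates (prod_row_series_sum), and its
    coefficient counts the coordinates of weight n, which are in bijection with
    the diamonds of n (card_codes). *)

Set Implicit Arguments.
Unset Strict Implicit.
Unset Printing Implicit Defensive.

Lemma mul1B_sum_expr (A : comNzRingType) (x : A) n :
  (1 - x) * (\sum_(i < n) x ^+ i) = 1 - x ^+ n.
Proof. by rewrite -[RHS]opprB subrX1 -[RHS]mulNr opprB. Qed.

(** * Congruence of power series modulo powers of q *)

Section Truncation.
Variable R : comNzRingType.
Implicit Types (f g h : fps R) (N : nat).

(** Congruence modulo q^N. Convergence only concerns one coefficient at a
    time, so infinite sums and products may be replaced by finite ones modulo
    a large power of q. *)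
Definition eqmodX N f g := forall k, (k < N)%N -> f k = g k.

Lemma eqmodX_refl N f : eqmodX N f f. Proof. by []. Qed.

Lemma eqmodX_trans N f g h : eqmodX N f g -> eqmodX N g h -> eqmodX N f h.
Proof. by move=> fg gh k kN; rewrite fg ?gh. Qed.

Lemma eqmodX_sym N f g : eqmodX N f g -> eqmodX N g f.
Proof. by move=> fg k kN; rewrite fg. Qed.

Lemma eqmodXB N f f' g g' : eqmodX N f f' -> eqmodX N g g' -> eqmodX N (f - g) (f' - g').
Proof.
move=> ff gg k kN; change (f k - g k = f' k - g' k).
by rewrite ff ?gg.
Qed.

Lemma eqmodXM N f f' g g' : eqmodX N f f' -> eqmodX N g g' -> eqmodX N (f * g) (f' * g').
Proof.
move=> ff gg k kN.
apply: eq_bigr => i _; rewrite ff ?gg //.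
  exact: leq_ltn_trans (leq_subr _ _) kN.
by apply: leq_ltn_trans kN; rewrite -ltnS.
Qed.

Lemma eqmodX_prod N (I : Type) (s : seq I) (F G : I -> fps R) :
  (forall i, eqmodX N (F i) (G i)) -> eqmodX N (\prod_(i <- s) F i) (\prod_(i <- s) G i).
Proof.
move=> FG; elim/big_ind2: _ => //.
by move=> *; apply: eqmodXM.
Qed.

Lemma eqmodX_unitI N u f g : u \is a GRing.unit -> eqmodX N (u * f) (u * g) -> eqmodX N f g.
Proof.
move=> uu /(eqmodXM (@eqmodX_refl N u^-1)).
by rewrite !mulrA mulVr // !mul1r.
Qed.

Lemma fps_coefXM f k : (fps_X R * f) k = if k is k'.+1 then f k' else 0.
Proof.
change (\sum_(i < k.+1) fps_X R i * f (k - i)%N = if k is k'.+1 then f k' else 0).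
rewrite big_ord_recl /= mul0r add0r; case: k => [|k]; first by rewrite big_ord0.
rewrite big_ord_recl /= mul1r subSS subn0 big1 ?addr0 // => i _.
by rewrite mul0r.
Qed.

Lemma fps_coefXnM n f k :
  (fps_X R ^+ n * f) k = if (k < n)%N then 0 else f (k - n)%N.
Proof.
elim: n k => [|n IH] k; first by rewrite mul1r subn0.
by rewrite exprS -mulrA fps_coefXM; case: k => [//|k]; rewrite IH ltnS subSS.
Qed.

Lemma fps_coefXn n k : (fps_X R ^+ n) k = (k == n)%:R.
Proof.
rewrite -[_ ^+ n]mulr1 fps_coefXnM.
change ((if (k < n)%N then 0 else if (k - n == 0)%N then 1 else 0) = (k == n)%:R :> R).
by rewrite subn_eq0; case: ltngtP => //.
Qed.

Lemma eqmodX_Xn N f : eqmodX N (fps_X R ^+ N * f) 0.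
Proof. by move=> k kN; rewrite fps_coefXnM kN. Qed.

(** The inverse is the geometric series in u = q h: as q^i divides u^i, the
    series is defined coefficientwise and its first N coefficients are those
    of the sum of the u^i for i < N. *)
Lemma unit_subX h : 1 - fps_X R * h \is a GRing.unit.
Proof.
set u := fps_X R * h.
pose g : fps R := FPS (fun k => (\sum_(i < k.+1) u ^+ i) k).
have eqg N : eqmodX N g (\sum_(i < N) u ^+ i).
  elim: N => [|N IH] k; first by [].
  rewrite ltnS leq_eqVlt => /predU1P[->//|kN].
  rewrite (IH _ kN) big_ord_recr.
  change ((\sum_(i < N) u ^+ i) k = (\sum_(i < N) u ^+ i) k + (u ^+ N) k).
  by rewrite exprMn (eqmodX_Xn _ kN) addr0.
have gu : (1 - u) * g = 1.
  apply: fpsP => k.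
  rewrite (eqmodXM (@eqmodX_refl k.+1 (1 - u)) (eqg k.+1)) //.
  rewrite mul1B_sum_expr.
  change ((1 : fps R) k - (u ^+ k.+1) k = (1 : fps R) k).
  by rewrite exprMn eqmodX_Xn // subr0.
by apply/unitrPr; exists g.
Qed.

Lemma unit_subXn n : 1 - fps_X R ^+ n.+1 \is a GRing.unit.
Proof. by rewrite exprS unit_subX. Qed.
End Truncation.

(** * Evaluation of bivariate polynomials and the recurrence of F *)

Section Eval2.
Variables (A : comNzRingType).
Implicit Types (P Q : {poly {poly int}}) (x y : A).

(** The inner evaluation, packaged as a ring morphism so that eval2 inherits
    the morphism lemmas of map_poly and horner. *)
Definition eval1 x : {rmorphism {poly int} -> A} := horner_eval x \o map_poly intr.

Lemma eval2E P x y : eval2 P x y = (map_poly (eval1 x) P).[y].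
Proof. by []. Qed.

Lemma eval2M P Q x y : eval2 (P * Q) x y = eval2 P x y * eval2 Q x y.
Proof. by rewrite !eval2E rmorphM hornerM. Qed.
Lemma eval2B P Q x y : eval2 (P - Q) x y = eval2 P x y - eval2 Q x y.
Proof. by rewrite !eval2E rmorphB hornerD hornerN. Qed.
Lemma eval2_1 x y : eval2 1 x y = 1.
Proof. by rewrite !eval2E rmorph1 hornerC. Qed.
Lemma eval2_q0 x y : eval2 q0 x y = x.
Proof. by rewrite eval2E map_polyC hornerC /= /horner_eval map_polyX hornerX. Qed.
Lemma eval2_w x y : eval2 w x y = y.
Proof. by rewrite eval2E map_polyX hornerX. Qed.
Lemma eval2X P n x y : eval2 (P ^+ n) x y = eval2 P x y ^+ n.
Proof. by rewrite !eval2E rmorphXn horner_exp. Qed.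
End Eval2.

Lemma rmorph_eval2 (A B : comNzRingType) (phi : {rmorphism A -> B}) P x y :
  phi (eval2 P x y) = eval2 P (phi x) (phi y).
Proof.
rewrite !eval2E -horner_map -map_poly_comp; congr (_.[_]).
apply: eq_map_poly => p /=; rewrite /horner_eval -horner_map -map_poly_comp.
congr (_.[_]); apply: eq_map_poly => c /=; exact: rmorph_int.
Qed.

(** Evaluation is a ring morphism, hence commutes with substitution. This
    turns the F_(d-1)(q0 w, w) of the recurrence into a value of F_(d-1). *)
Lemma eval2_comp (A : comNzRingType) P u v (x y : A) :
  eval2 (eval2 P u v) x y = eval2 P (eval2 u x y) (eval2 v x y).
Proof.
exact: (rmorph_eval2 (horner_eval y \o map_poly (eval1 x))).
Qed.

(** Since 1 - q0 w - w (1 - q0) = 1 - w, the recurrence also produces F_1 = 1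
    from the value F_0 = 1, so inductions on d may start at 0. *)
Lemma eval2_F_rec d (A : comNzRingType) (x y : A) :
  (1 - y) * eval2 (F d.+1) x y =
  (1 - x * y ^+ d.+1) * eval2 (F d) x y - y * (1 - x) * eval2 (F d) (x * y) y.
Proof.
case: d => [|d]; first by rewrite /= !eval2_1 expr1; ring.
have /(congr1 (fun P => eval2 P x y)) := @F_recE d.+2 isT.
rewrite !(eval2M, eval2B, eval2_1, eval2_q0, eval2_w, eval2X, eval2_comp).
by rewrite mulrC.
Qed.

(** * The generating function of one row *)

Section RowSeries.
Variable R : comNzRingType.
Local Notation q := (fps_X R).

(** The q-analogue of k + 1: generating function of one integer between 0
    and k. *)
Definition qnum k : fps R := \sum_(j < k.+1) q ^+ j.

(** Contribution of one row of a diamond, cut off at drops k < K: each unit of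
    the drop k = a_(i-1) - a_i raises c parts, and each of the d middle parts
    exceeds a_i by some amount between 0 and k. *)
Definition row_series d K c : fps R :=
  \sum_(k < K) q ^+ (c * k) * qnum k ^+ d.

(** One of the factors qnum k, multiplied by 1 - q, is 1 - q^(k+1), and the
    factor q^k is absorbed by moving c to c + 1. This is the shape of the
    recurrence of F. *)
Lemma row_series_rec d K c :
  (1 - q) * row_series d.+1 K c = row_series d K c - q * row_series d K c.+1.
Proof.
rewrite !mulr_sumr -sumrB; apply: eq_bigr => k _.
transitivity (q ^+ (c * k) * qnum k ^+ d * ((1 - q) * qnum k)).
  by rewrite exprSr; ring.
by rewrite mul1B_sum_expr mulSnr exprD exprS; ring.
Qed.

(** The series is F_d(q^c, q) over the product of the 1 - q^(c+m), m <= d.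
    In the induction on d, the products for (d, c) and (d, c + 1) are those
    of (d + 1, c) without the last and without the first factor, and these
    missing factors are, up to a factor q, the coefficients in the recurrence
    of F. The base
    case is a geometric series, which is where the truncation enters. *)
Lemma row_seriesP d K c : (0 < c)%N ->
  eqmodX K ((\prod_(m < d.+1) (1 - q ^+ (c + m))) * row_series d K c)
        (eval2 (F d) (q ^+ c) q).
Proof.
elim: d c => [|d IH] c c0.
  rewrite big_ord_recl big_ord0 mulr1 addn0 eval2_1.
  have -> : row_series 0 K c = \sum_(k < K) (q ^+ c) ^+ k.
    by apply: eq_bigr => k _; rewrite mulr1 exprM.
  rewrite mul1B_sum_expr -[X in eqmodX _ _ X]subr0.
  apply: eqmodXB; first exact: eqmodX_refl.
  rewrite -exprM -(subnK (leq_pmull K c0)) addnC exprD.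
  exact: eqmodX_Xn.
apply: (eqmodX_unitI (u := 1 - q)); first exact: unit_subXn 0%N.
rewrite eval2_F_rec mulrCA row_series_rec mulrBr.
apply: eqmodXB.
  rewrite big_ord_recr /= mulrAC mulrC -exprD.
  by apply: eqmodXM; [exact: eqmodX_refl|exact: IH].
have -> : \prod_(m < d.+2) (1 - q ^+ (c + m)) =
    (1 - q ^+ c) * \prod_(m < d.+1) (1 - q ^+ (c.+1 + m)).
  by rewrite big_ord_recl addn0; congr (_ * _); apply: eq_bigr => m _; rewrite addSnnS.
set P := \prod_(m < _) _.
have -> : (1 - q ^+ c) * P * (q * row_series d K c.+1) =
   q * (1 - q ^+ c) * (P * row_series d K c.+1) by ring.
by apply: eqmodXM; [exact: eqmodX_refl|rewrite -exprSr; exact: IH].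
Qed.

(** The denominators of consecutive rows occupy consecutive blocks of d + 1
    exponents, so the first M rows use the 1 - q^n with n <= M (d + 1); those
    with n > M are 1 modulo q^M. *)
Lemma prod_row_series d M :
  eqmodX M (\prod_(i < M) row_series d M (i * d.+1).+1)
    (\prod_(1 <= n < M.+1)
       (eval2 (F d) (q ^+ ((n - 1) * (d + 1) + 1)) q / (1 - q ^+ n))).
Proof.
have u1 n : 1 - q ^+ n.+1 \is a GRing.unit by exact: unit_subXn.
pose D := \prod_(0 <= n < M) (1 - q ^+ n.+1).
have uD : D \is a GRing.unit by apply: rpred_prod.
apply: (eqmodX_unitI uD).
have -> : D * \prod_(1 <= n < M.+1)
       (eval2 (F d) (q ^+ ((n - 1) * (d + 1) + 1)) q / (1 - q ^+ n)) =
   \prod_(i < M) eval2 (F d) (q ^+ (i * d.+1).+1) q.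
  rewrite big_add1 -big_split /= big_mkord; apply: eq_bigr => i _.
  by rewrite mulrC divrK // subn1 !addn1.
apply: eqmodX_trans (eqmodX_prod _ (fun i : 'I_M => @row_seriesP d M _ (ltn0Sn (i * d.+1)))).
rewrite big_split /=; apply: eqmodXM => //.
have -> : \prod_(i < M) \prod_(m < d.+1) (1 - q ^+ ((i * d.+1).+1 + m)) =
   \prod_(0 <= n < M * d.+1) (1 - q ^+ n.+1).
  rewrite big_nat_mul big_mkord; apply: eq_bigr => i _.
  rewrite -[X in \prod_(X <= _ < _) _]add0n big_addn mulSn addnK big_mkord.
  by apply: eq_bigr => m _; rewrite addSn addnC.
rewrite (@big_cat_nat _ _ _ M _ _ _ _ (leq0n M)) /= ?leq_pmulr //.
rewrite -[X in eqmodX _ X _]mulr1; apply: eqmodXM => //; apply: eqmodX_sym.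
rewrite big_seq; elim/big_ind: _ => // [f g f1 g1|n].
  by rewrite -[X in eqmodX _ _ X]mulr1; apply: eqmodXM.
rewrite mem_index_iota => /andP[Mn _].
rewrite -[X in eqmodX _ _ X]subr0; apply: eqmodXB => //.
rewrite -(subnK (leqW Mn)) addnC exprD; exact: eqmodX_Xn.
Qed.
End RowSeries.

(** * Counting row coordinates by weight *)

(** Local coordinates of a diamond with rows i <= N: the component i holds the
    drop a_i - a_(i+1) and the excesses over a_(i+1) of the middle parts
    between a_i and a_(i+1). *)
Definition code d N := {ffun 'I_N.+1 -> 'I_N.+1 * {ffun 'I_d -> 'I_N.+1}}.

Definition admissible d N (f : code d N) :=
  [forall i, forall j, (f i).2 j <= (f i).1]%N.

(** A unit of the drop of row i raises the i + 1 parts a_0, ..., a_i and the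
    d i middle parts above a_i, which makes i (d + 1) + 1 parts. *)
Definition weight d N (f : code d N) : nat :=
  (\sum_(i < N.+1) ((i * d.+1).+1 * (f i).1 + \sum_(j < d) (f i).2 j))%N.

Section CodeSeries.
Variable R : comNzRingType.
Local Notation q := (fps_X R).

(** The d-th power of qnum k, expanded by distributivity, is a sum over the
    d-tuples of integers between 0 and k. *)
Lemma row_series_sum d N c :
  row_series R d N.+1 c =
  \sum_(p : 'I_N.+1 * {ffun 'I_d -> 'I_N.+1} | [forall j, (p.2 j <= p.1)%N])
    q ^+ (c * p.1 + \sum_(j < d) p.2 j).
Proof.
rewrite -(pair_big_dep xpredT
  (fun (k : 'I_N.+1) (g : {ffun 'I_d -> 'I_N.+1}) => [forall j, (g j <= k)%N])
  (fun (k : 'I_N.+1) (g : {ffun 'I_d -> 'I_N.+1}) => q ^+ (c * k + \sum_(j < d) g j))) /=.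
apply: eq_bigr => k _.
have -> : qnum R k = \sum_(j < N.+1 | (j < k.+1)%N) q ^+ j.
  exact: (big_ord_widen _ (fun j => q ^+ j)).
set u := \sum_(j < _ | _) _.
have -> : u ^+ d = \prod_(j < d) u by rewrite prodr_const card_ord.
rewrite bigA_distr_big /= mulr_sumr.
apply: eq_big => [g|g _]; last by rewrite exprD -prodrXr.
by apply/ffun_onP/forallP.
Qed.

Lemma prod_row_series_sum d N :
  \prod_(i < N.+1) row_series R d N.+1 (i * d.+1).+1 =
  \sum_(f : code d N | admissible f) q ^+ weight f.
Proof.
under eq_bigr => i _ do rewrite row_series_sum.
rewrite bigA_distr_big; apply: eq_big => [f|f _]; last by rewrite prodrXr.
by apply/ffun_onP/forallP.
Qed.

Lemma coef_sum_Xn (I : finType) (P : pred I) (wt : I -> nat) n :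
  (\sum_(i | P i) q ^+ wt i) n = #|[pred i | P i && (wt i == n)]|%:R.
Proof.
have -> : (\sum_(i | P i) q ^+ wt i) n = \sum_(i | P i) (q ^+ wt i) n.
  exact: (big_morph (fun f : fps R => f n)).
rewrite -sum1_card natr_sum big_mkcondr /=.
by apply: eq_bigr => i _; rewrite fps_coefXn eq_sym; case: eqP.
Qed.
End CodeSeries.

(** * Diamonds and their row coordinates *)

Lemma card_fset_set_bij (T : choiceType) (A : set T) (I : finType) (P : pred I)
    (F : I -> T) (G : T -> I) :
  finite_set A -> (forall i, P i -> A (F i) /\ G (F i) = i) ->
  (forall x, A x -> P (G x) /\ F (G x) = x) -> #|` fset_set A| = #|P|.
Proof.
move=> finA PF AG.
have -> : fset_set A = [fset x in [seq F i | i in P]]%fset.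
  apply/fsetP => x; rewrite in_fset_set // !inE.
  apply/idP/fintype.imageP => [/set_mem/AG[PG FG]|[i Pi ->]].
    by exists (G x).
  by apply/mem_set; case: (PF i Pi).
rewrite card_fseq undup_id ?size_image //.
rewrite map_inj_in_uniq ?enum_uniq // => i j; rewrite !mem_enum => Pi Pj E.
by rewrite -(PF i Pi).2 E (PF j Pj).2.
Qed.

Lemma sum_finsupp (K : choiceType) (f : {fsfun K -> nat with 0%N}) (s : seq K) :
  uniq s -> (forall x, x \notin s -> f x = 0%N) ->
  (\sum_(x <- finsupp f) f x = \sum_(x <- s) f x)%N.
Proof.
move=> us fs; apply/eqP; rewrite eqn_leq leq_sum_finsupp // andbT.
apply: (uniq_sub_le_big leqnn (fun x y => leq_addr y x)) => [||x] //.
by rewrite mem_finsupp; apply: contraR => /fs ->.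
Qed.

Lemma fsfun_seqE (K : choiceType) (s : seq K) (h : K -> nat) x :
  ([fsfun y in [fset z in s]%fset => h y] : {fsfun K -> nat with 0%N}) x =
  if x \in s then h x else 0%N.
Proof. by rewrite fsfunE inE. Qed.

(** Summation by parts. *)
Lemma sum_drops (a : nat -> nat) M : (forall i, a i.+1 <= a i)%N ->
  (\sum_(i < M) a i = \sum_(i < M) i.+1 * (a i - a i.+1) + M * a M)%N.
Proof.
move=> da; elim: M => [|M IH]; first by rewrite !big_ord0.
rewrite !big_ord_recr [in LHS]/= IH -[LHS]addnA -[RHS]addnA; congr (_ + _)%N.
by rewrite -mulSnr -[in LHS](subnK (da M)) mulnDr.
Qed.

Section DiamondCode.
Variables d N : nat.
Implicit Types (f : code d N) (D : parts d).

Definition encode D : code d N :=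
  [ffun i : 'I_N.+1 => (inord (D.1 i - D.1 i.+1),
              [ffun j => inord (D.2 (val i, j) - D.1 i.+1)])].

(** The parts are recovered by summing the drops below them. Both functions
    are total on nat and vanish beyond row N, so no bound on i has to be
    carried along. *)
Definition code_a f i : nat := (\sum_(m < N.+1 | i <= m) (f m).1)%N.
Definition code_b f (ij : nat * 'I_d) : nat :=
  (code_a f ij.1.+1 + \sum_(m < N.+1 | m == ij.1 :> nat) (f m).2 ij.2)%N.

Definition decode f : parts d :=
  ([fsfun i in [fset x in iota 0 N.+1]%fset => code_a f i],
   [fsfun ij in [fset x in [seq (i, j) | i <- iota 0 N.+1, j <- enum 'I_d]]%fset
      => code_b f ij]).

Lemma code_a0 f i : (N < i)%N -> code_a f i = 0%N.
Proof.
move=> Ni; apply: big_pred0 => m; apply: contraTF (Ni) => im.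
by rewrite -leqNgt (leq_trans im) // -ltnS.
Qed.

Lemma code_aS f (i : 'I_N.+1) : code_a f i = ((f i).1 + code_a f i.+1)%N.
Proof.
rewrite /code_a (bigD1 i) //=; congr (_ + _)%N; apply: eq_bigl => m.
by rewrite ltn_neqAle andbC eq_sym.
Qed.

Lemma code_bE f (i : 'I_N.+1) j :
  code_b f (val i, j) = (code_a f i.+1 + (f i).2 j)%N.
Proof. by congr (_ + _)%N; apply: (big_pred1 i). Qed.

Lemma code_b0 f ij : (N < ij.1)%N -> code_b f ij = 0%N.
Proof.
move=> Ni; rewrite /code_b code_a0 ?(leqW Ni) //.
by apply: big_pred0 => m; apply: contraTF (Ni) => /eqP <-; rewrite -leqNgt -ltnS.
Qed.

Lemma decode1E f i : (decode f).1 i = code_a f i.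
Proof.
rewrite fsfun_seqE mem_iota add0n ltnS /=.
by case: leqP => // /code_a0 ->.
Qed.

Lemma mem_rows i (j : 'I_d) :
  ((i, j) \in [seq (i, j) | i <- iota 0 N.+1, j <- enum 'I_d]) = (i <= N)%N.
Proof.
apply/allpairsP/idP => [[[i' j'] [h _ [-> _]]]|iN].
  by rewrite mem_iota in h.
by exists (i, j); rewrite mem_enum mem_iota.
Qed.

Lemma decode2E f ij : (decode f).2 ij = code_b f ij.
Proof.
case: ij => i j; rewrite fsfun_seqE mem_rows.
by case: leqP => // Ni; rewrite code_b0.
Qed.

Lemma decode_diamond f : admissible f -> is_diamond (decode f).
Proof.
move=> /forallP adm i j; rewrite decode2E !decode1E.
case: (leqP i N) => [iN|Ni]; last by rewrite code_b0 ?code_a0 // (leqW Ni).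
have := code_aS f (Ordinal (iN : i < N.+1)%N); rewrite /= => ->.
have := code_bE f (Ordinal (iN : i < N.+1)%N) j; rewrite /= => ->.
rewrite leq_addr addnC leq_add2r; split=> //.
exact: (forallP (adm _)).
Qed.

Lemma decodeK f : encode (decode f) = f.
Proof.
apply/ffunP => i; rewrite ffunE decode1E code_aS decode1E addnK inord_val.
case E : (f i) => [k c] /=; congr pair; apply/ffunP => j; rewrite ffunE.
by rewrite decode2E code_bE addKn E inord_val.
Qed.

Section Encode.
Variable D : parts d.
Hypothesis d0 : (0 < d)%N.
Hypothesis diaD : is_diamond D.
Hypothesis D10 : forall i, (N < i)%N -> D.1 i = 0%N.

Let D1S i : (D.1 i.+1 <= D.1 i)%N.
Proof. by have [h1 h2] := diaD i (Ordinal d0); apply: leq_trans h2 h1. Qed.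

Let D20 i j : (N < i)%N -> D.2 (i, j) = 0%N.
Proof. by move=> Ni; apply/eqP; have [] := diaD i j; rewrite D10 // leqn0. Qed.

(** The middle parts split into an excess and a copy of a_(i+1). Summation by
    parts gives total (i + 1) drop_i for the a_i and total i drop_i for the
    a_(i+1), which occur d times. *)
Lemma diamond_sum_rows :
  diamond_sum D = (\sum_(i < N.+1) ((i * d.+1).+1 * (D.1 i - D.1 i.+1)
     + \sum_(j < d) (D.2 (val i, j) - D.1 i.+1)))%N.
Proof.
have -> : diamond_sum D =
    (\sum_(i < N.+1) D.1 i + \sum_(i < N.+1) \sum_(j < d) D.2 (val i, j))%N.
  congr (_ + _)%N.
    rewrite (sum_finsupp (iota_uniq 0 N.+1)) => [|i].
      by rewrite -(big_mkord xpredT D.1) /index_iota subn0.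
    by rewrite mem_iota add0n /= -leqNgt => /D10.
  rewrite (sum_finsupp (s := [seq (i, j) | i <- iota 0 N.+1, j <- enum 'I_d])).
  - rewrite big_allpairs -(big_mkord xpredT (fun i => \sum_(j < d) D.2 (i, j))%N).
    by rewrite /index_iota subn0; apply: eq_bigr => i _; rewrite big_enum.
  - by apply: allpairs_uniq => [||[? ?] [? ?]]; rewrite ?iota_uniq ?enum_uniq.
  - by move=> [i j]; rewrite mem_rows -ltnNge => /D20.
pose S := (\sum_(i < N.+1) i * (D.1 i - D.1 i.+1))%N.
have sumS : (\sum_(i < N.+1) D.1 i.+1 = S)%N.
  have := @sum_drops D.1 N.+1 D1S; rewrite D10 // muln0 addn0.
  under [X in _ = X -> _]eq_bigr do rewrite mulSn.
  have -> : (\sum_(i < N.+1) D.1 i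
      = \sum_(i < N.+1) (D.1 i - D.1 i.+1) + \sum_(i < N.+1) D.1 i.+1)%N.
    by rewrite -big_split; apply: eq_bigr => i _ /=; rewrite subnK.
  by rewrite big_split => /addnI.
have -> : (\sum_(i < N.+1) ((i * d.+1).+1 * (D.1 i - D.1 i.+1)
     + \sum_(j < d) (D.2 (val i, j) - D.1 i.+1)) =
   \sum_(i < N.+1) (D.1 i - D.1 i.+1) + d.+1 * S
     + \sum_(i < N.+1) \sum_(j < d) (D.2 (val i, j) - D.1 i.+1))%N.
  rewrite big_distrr -!big_split; apply: eq_bigr => i _ /=.
  by rewrite mulSn mulnA [(d.+1 * _)%N]mulnC.
rewrite mulSn -sumS.
have -> : (\sum_(i < N.+1) \sum_(j < d) D.2 (val i, j) =
  d * \sum_(i < N.+1) D.1 i.+1 + \sum_(i < N.+1) \sum_(j < d) (D.2 (val i, j) - D.1 i.+1))%N.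
  rewrite big_distrr -big_split; apply: eq_bigr => i _ /=.
  rewrite -[X in (X * _)%N]card_ord -sum_nat_const -big_split /=.
  by apply: eq_bigr => j _; rewrite subnKC //; case: (diaD i j).
rewrite !addnA; congr (_ + _ + _)%N; rewrite -big_split.
by apply: eq_bigr => i _ /=; rewrite subnK.
Qed.

Hypothesis DN : (D.1 0 <= N)%N.

Let D1N i : (D.1 i <= N)%N.
Proof. by elim: i => // i; apply: leq_trans. Qed.

Let encodeE (i : 'I_N.+1) : ((encode D i).1 = D.1 i - D.1 i.+1 :> nat)%N *
  (forall j, ((encode D i).2 j = D.2 (val i, j) - D.1 i.+1 :> nat)%N).
Proof.
rewrite ffunE; split=> [|j]; rewrite /= ?ffunE inordK // ltnS (leq_trans (leq_subr _ _)) //.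
by apply: leq_trans (D1N i); case: (diaD i j).
Qed.

Lemma encode_admissible : admissible (encode D).
Proof.
apply/forallP => i; apply/forallP => j.
by rewrite !encodeE leq_sub2r //; case: (diaD i j).
Qed.

Lemma weight_encode : weight (encode D) = diamond_sum D.
Proof.
rewrite diamond_sum_rows; apply: eq_bigr => i _; rewrite encodeE.
by congr (_ + _)%N; apply: eq_bigr => j _; rewrite encodeE.
Qed.

Lemma encodeK : decode (encode D) = D.
Proof.
have Ea i : code_a (encode D) i = D.1 i.
  case: (ltnP N i) => [Ni|iN]; first by rewrite code_a0 // D10.
  have [k] : exists k, (i + k = N.+1)%N.
    by exists (N.+1 - i)%N; rewrite subnKC // leqW.
  (* downward induction on i, starting below the last row *)
  elim: k i {iN} => [|k IH] i; first by rewrite addn0 => ->; rewrite code_a0 // D10.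
  move=> ik; have iN : (i < N.+1)%N by rewrite -ik -addSnnS leq_addr.
  rewrite -[i]/(val (Ordinal iN)) code_aS encodeE IH ?addSnnS //.
  exact: subnK.
rewrite [RHS]surjective_pairing; congr pair; apply/fsfunP.
  by move=> i; rewrite decode1E Ea.
case=> i j.
rewrite decode2E; case: (leqP i N) => [iN|Ni]; last by rewrite code_b0 // D20.
rewrite -[i]/(val (Ordinal (iN : i < N.+1)%N)) code_bE encodeE Ea subnKC //.
by case: (diaD i j).
Qed.
End Encode.

Lemma weight_decode f : (0 < d)%N -> admissible f ->
  weight f = diamond_sum (decode f).
Proof.
move=> d0 adm; rewrite (diamond_sum_rows d0 (decode_diamond adm)); last first.
  by move=> i; rewrite decode1E; exact: code_a0.
apply: eq_bigr => i _; rewrite !decode1E code_aS addnK; congr (_ + _)%N.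
by apply: eq_bigr => j _; rewrite decode2E code_bE addKn.
Qed.

(** A diamond of n <= N has all parts at most n and no nonzero part beyond
    row n, so its coordinates fit in 'I_N.+1. *)
Lemma card_codes n : (0 < d)%N -> (n <= N)%N ->
  #|[pred f : code d N | admissible f && (weight f == n)]| = r d n.
Proof.
move=> d0 nN; symmetry.
apply: (card_fset_set_bij (F := decode) (G := encode)).
- exact: diamonds_finite.
- move=> f /= /andP[adm /eqP wf]; split; last exact: decodeK.
  by split; [exact: decode_diamond|rewrite -weight_decode].
- move=> D AD; have [Da _ Dn] := diamonds_bound d0 AD.
  have D10 i : (N < i)%N -> D.1 i = 0%N.
    by move=> Ni; case: (Dn i (leq_ltn_trans nN Ni)).
  have DN : (D.1 0 <= N)%N by apply: leq_trans (Da 0%N) nN.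
  case: AD => diaD sumD; split; last exact: encodeK.
  by rewrite /= encode_admissible // weight_encode // sumD eqxx.
Qed.
End DiamondCode.

(** * The product formula *)

Lemma coef_prod_row_series (R : comNzRingType) d N n : (0 < d)%N -> (n <= N)%N ->
  (\prod_(i < N.+1) row_series R d N.+1 (i * d.+1).+1) n = (r d n)%:R.
Proof.
by move=> d0 nN; rewrite prod_row_series_sum coef_sum_Xn card_codes.
Qed.

Unset Implicit Arguments.

Theorem theorem1p1 (d : nat) (hd : (1 <= d)%N) :
  let q : fps int := fps_X int in
  fps_prod_cvg
    (fun n => eval2 (F d) (q ^+ ((n - 1) * (d + 1) + 1)) q / (1 - q ^+ n))
    (FPS (fun n => (r d n)%:Z)).
Proof.
move=> q n; exists n.+1 => -[//|M]; rewrite ltnS => nM.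
by rewrite -(@prod_row_series _ d M.+1 n) ?ltnS // coef_prod_row_series // natz.
Qed.
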